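(* For every prime $p \geq 5$, $rb(\mathbb{Z}_p, 1) = 4$.
   Context: $\mathbb{Z}_n$ denotes the cyclic group of order $n$. An $r$-coloring of $\mathbb{Z}_n$ is a surjective map $c:\mathbb{Z}_n\to\{1,\dots,r\}$. For a fixed integer $k$, a triple is any $(x_1,x_2,x_3)\in\mathbb{Z}_n^3$ with $x_1+x_2\equiv kx_3 \pmod n$. A triple is rainbow under $c$ if $c(x_1),c(x_2),c(x_3)$ are pairwise distinct; $c$ is rainbow-free if no triple is rainbow. The rainbow number $rb(\mathbb{Z}_n,k)$ is the smallest positive integer $r$ such that every $r$-coloring of $\mathbb{Z}_n$ admits a rainbow triple (by convention $rb(\mathbb{Z}_n,k)=n+1$ if no such $r$ exists). *)

(* Defs.v *)
From mathcomp Require Import all_boot all_order all_algebra.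

Set Implicit Arguments.
Unset Strict Implicit.
Unset Printing Implicit Defensive.

(* Z_n is carried by 'I_n with explicit congruences modulo n, not by 'Z_n,
   whose carrier is Z/2 for n = 0, 1.  The r colors are numbered 0, ..., r-1. *)

Definition coloring (n r : nat) (c : {ffun 'I_n -> 'I_r}) : bool :=
  [forall a : 'I_r, exists x : 'I_n, c x == a].

Definition triple (n : nat) (k : int) (x1 x2 x3 : 'I_n) : bool :=
  (x1%:Z + x2%:Z == k * x3%:Z %[mod n%:Z])%Z.

Definition rainbow (n r : nat) (c : {ffun 'I_n -> 'I_r})
    (x1 x2 x3 : 'I_n) : bool :=
  [&& c x1 != c x2, c x1 != c x3 & c x2 != c x3].

Definition has_rainbow_triple (n r : nat) (k : int)
    (c : {ffun 'I_n -> 'I_r}) : bool :=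
  [exists x1 : 'I_n, exists x2 : 'I_n, exists x3 : 'I_n,
    triple k x1 x2 x3 && rainbow c x1 x2 x3].

Definition unavoidable (n : nat) (k : int) (r : nat) : bool :=
  [forall c : {ffun 'I_n -> 'I_r}, coloring c ==> has_rainbow_triple k c].

Lemma coloring_leq (n r : nat) (c : {ffun 'I_n -> 'I_r}) :
  coloring c -> r <= n.
Proof.
move=> /forallP c_surj; rewrite -[r]card_ord -[n]card_ord.
have codT a : a \in codom c.
  by case/existsP: (c_surj a) => x /eqP <-; exact: codom_f.
by rewrite (leq_trans _ (leq_image_card c predT)) // subset_leq_card //;
  apply/subsetP => a _; exact: codT.
Qed.

Lemma unavoidable_ex (n : nat) (k : int) :
  exists r, (0 < r) && unavoidable n k r.
Proof.
exists n.+1; apply/forallP => c; apply/implyP => /coloring_leq.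
by rewrite ltnn.
Qed.

(* There is no (n+1)-coloring of Z_n, so r = n+1 is vacuously unavoidable: the
   minimum below is n+1 exactly when no r <= n is unavoidable, which is the
   usual convention for that case. *)
Definition rb (n : nat) (k : int) : nat := ex_minn (unavoidable_ex n k).

(* Main.v *)
Require Import Defs.
From mathcomp Require Import all_boot all_order all_algebra.
From mathcomp Require Import zify.

(** Lower bound: give 0 the color 0, the elements 1 and -1 the color 1, and
    everything else the color 2; a sum involving 0 has two equal terms up to
    sign, so no triple is rainbow.

    Upper bound: let [f] be rainbow-free with at least four colors and let [a]
    be nonzero.  Along the progressions of step [a], two consecutive terms not
    of color [f a] have the same color, so runs avoiding [f a] are
    monochromatic.  Suppose that some run has length at least 2; let [B] be its
    color, and choose [y] nonzero of a color other than [f a] and [B].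
    Translating the run by [y], [2y], ... yields runs avoiding [f a]; they
    cannot all have color [B], since the multiples of [y] exhaust the group, so
    some translate has the color of [y].  The sum of the two runs is then a
    longer run, and so on, which is absurd.  Hence [x] or [x + a] has color
    [f a], for every [x].  Applied to nonzero [a], [b] of distinct colors and
    to [x] of a third color, this forces [x + a + b] to have both colors. *)

Set Implicit Arguments.
Unset Strict Implicit.
Unset Printing Implicit Defensive.

Section RainbowFree.

Import GRing.Theory.
Local Open Scope ring_scope.

Variables (V : zmodType) (n : nat) (T : eqType) (f : V -> T).

Hypothesis multiples :
  forall y z : V, y != 0 -> exists2 k, (k < n)%N & z = y *+ k.
Hypothesis rainbow_free :
  forall x y, f x != f y -> f (x + y) \in [:: f x; f y].
Hypothesis four_colors :
  forall t1 t2 t3 : T, exists x, f x \notin [:: t1; t2; t3].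

(** A run has [m.+1] terms, as [i = m] is included. *)
Let avoids a x m := forall i, (i <= m)%N -> f (x + a *+ i) != f a.

Lemma avoids_monochromatic a x m :
  avoids a x m -> forall i, (i <= m)%N -> f (x + a *+ i) = f x.
Proof.
move=> av; elim=> [|i IHi] lt_im; first by rewrite mulr0n addr0.
have := rainbow_free (av i (ltnW lt_im)); rewrite -addrA -mulrSr !inE.
by rewrite (negPf (av _ lt_im)) orbF => /eqP ->; apply/IHi/ltnW.
Qed.

Lemma avoids_longer a x m :
  (0 < m)%N -> avoids a x m -> exists x', avoids a x' m.+1.
Proof.
move=> m_gt0 av; have [y] := four_colors (f a) (f x) (f 0).
rewrite !inE !negb_or => /and3P[ya yx y0].
have y_neq0 : y != 0 by apply: contraNneq y0 => ->.
have xa : f x != f a by have := av 0%N isT; rewrite mulr0n addr0.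
have not_a t : t \in [:: f x; f y] -> t != f a by rewrite !inE => /orP[]/eqP->.
have [z avz fz] : exists2 z, avoids a z m & f z = f y.
  (* The [k]-th translate of [x] is [a] itself, so the color [f x] cannot persist that far. *)
  have [k _ ak] := multiples (a - x) y_neq0.
  have: (avoids a (x + y *+ k) m /\ f (x + y *+ k) = f x) \/
        (exists2 z, avoids a z m & f z = f y).
    elim: k {ak} => [|k [[avk fk]|]]; [by left; rewrite mulr0n addr0| |by right].
    have shift i (le_im : (i <= m)%N) :
        f (x + y *+ k.+1 + a *+ i) \in [:: f x; f y].
      have fi := avoids_monochromatic avk le_im.
      by rewrite mulrSr addrA (addrAC _ y) -fk -fi rainbow_free // fi fk eq_sym.
    have avk1 : avoids a (x + y *+ k.+1) m by move=> i /shift/not_a.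
    have := shift 0%N isT; rewrite mulr0n addr0 !inE => /orP[] /eqP fk1.
      by left.
    by right; exists (x + y *+ k.+1).
  by case=> [[_]|//]; rewrite -ak addrC subrK => fax; rewrite fax eqxx in xa.
exists (x + z) => i le_im1.
(* Since [m] is positive, [m.+1 <= m + m], so each term of the new run is a sum of terms of the two
   old ones. *)
have [j [l [le_jm le_lm ->]]] :
    exists j l, [/\ (j <= m)%N, (l <= m)%N & i = (j + l)%N].
  by exists (minn i m), (i - minn i m)%N; split; lia.
have fj := avoids_monochromatic av le_jm.
have fl := avoids_monochromatic avz le_lm.
by rewrite mulrnDr addrACA not_a // -fz -fj -fl rainbow_free // fj fl fz eq_sym.
Qed.

Lemma dominant_color a x : a != 0 -> f x != f a -> f (x + a) = f a.
Proof.
move=> a_neq0 xa; apply/eqP/negPn/negP => xaa.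
have long m : exists x', avoids a x' m.+1.
  elim: m => [|m [x' av]]; last exact: avoids_longer av.
  by exists x => -[|[|]] // _; rewrite ?mulr0n ?addr0.
have [x' av] := long n.
(* Some multiple of [a] with coefficient below [n] leads from [x'] to [a], inside a run that avoids
   [f a]. *)
have [k lt_kn ak] := multiples (a - x') a_neq0.
by have := av k (leqW (ltnW lt_kn)); rewrite -ak addrC subrK eqxx.
Qed.

Lemma no_rainbow_free_four_colors : False.
Proof.
have [a] := four_colors (f 0) (f 0) (f 0).
rewrite !inE !orbb => a0.
have [b] := four_colors (f 0) (f 0) (f a).
rewrite !inE orbA orbb negb_or => /andP[b0 ba].
have [c] := four_colors (f a) (f a) (f b).
rewrite !inE orbA orbb negb_or => /andP[ca cb].
have a_neq0 : a != 0 by apply: contraNneq a0 => ->.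
have b_neq0 : b != 0 by apply: contraNneq b0 => ->.
have fca := dominant_color a_neq0 ca; have fcb := dominant_color b_neq0 cb.
have fcab : f (c + a + b) = f b by apply: dominant_color; rewrite // fca eq_sym.
have fcba : f (c + b + a) = f a by apply: dominant_color; rewrite // fcb.
by move: ba; rewrite -fcab -fcba addrAC eqxx.
Qed.

End RainbowFree.

Section PrimeOrder.

Import GRing.Theory.
Local Open Scope ring_scope.

Variable q : nat.
Let p := q.+2.

Lemma Zp_multiples (y z : 'Z_p) :
  prime p -> y != 0 -> exists2 k, (k < p)%N & z = y *+ k.
Proof.
move=> p_pr y_neq0.
have Uy : y \is a GRing.unit.
  rewrite -[y]natr_Zp unitZpE // prime_coprime // gtnNdvd //.
  by rewrite lt0n; apply: contraNneq y_neq0 => y0; apply/eqP/val_inj.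
(* The residue [z / y], read as a natural number, is the multiplier. *)
by exists (y^-1 * z : 'Z_p) => //; rewrite -mulr_natr natr_Zp mulVKr.
Qed.

Lemma triple1E (x1 x2 x3 : 'I_p) : triple 1%Z x1 x2 x3 = (x1 + x2 == x3).
Proof.
rewrite /triple mul1r -PoszD !modz_nat eqz_nat -val_eqE /=.
by rewrite (modn_small (ltn_ord x3)).
Qed.

Lemma unavoidable4 : prime p -> unavoidable p 1%Z 4.
Proof.
move=> p_pr; apply/forallP => c; apply/implyP => /forallP c_surj.
apply: contraT => no_rainbow; exfalso.
apply: (@no_rainbow_free_four_colors 'I_p p _ c) => [y z|x y cxy|t1 t2 t3].
- exact: Zp_multiples.
- apply: contraR no_rainbow; rewrite !inE negb_or => /andP[cx cy].
  apply/existsP; exists x; apply/existsP; exists y; apply/existsP.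
  by exists (x + y); rewrite triple1E eqxx /rainbow cxy !(eq_sym _ (c (x + y))) cx.
- have [t t_new] : exists t, t \notin [:: t1; t2; t3].
    apply/existsP; rewrite -negb_forall; apply/negP => /forallP all_in.
    have := card_size [:: t1; t2; t3].
    by rewrite (eq_card (_ : _ =i 'I_4)) ?card_ord // => t; rewrite all_in.
  by have /existsP[x /eqP cx] := c_surj t; exists x; rewrite cx.
Qed.

Definition unit_color (x : 'I_p) : nat :=
  if x == 0 then 0 else if (x == 1) || (x == -1) then 1 else 2.

Lemma unit_color_rainbow_free (x y : 'I_p) :
  let g := unit_color in
  [|| g x == g y, g x == g (x + y) | g y == g (x + y)].
Proof.
have gN z : unit_color (- z) = unit_color z.
  by rewrite /unit_color oppr_eq0 eqr_opp eqr_oppLR orbC.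
have g0 z : (unit_color z == 0%N) = (z == 0).
  by rewrite /unit_color; case: (z == 0) => //; case: ifP.
have g2 z : (unit_color z <= 2)%N.
  by rewrite /unit_color; case: ifP => // _; case: ifP.
move=> /=; have [->|x0] := eqVneq x 0; first by rewrite add0r eqxx !orbT.
have [->|y0] := eqVneq y 0; first by rewrite addr0 eqxx !orbT.
have [/eqP|xy0] := eqVneq (x + y) 0.
  by rewrite addr_eq0 => /eqP ->; rewrite gN eqxx.
(* Three nonzero elements share the two colors 1 and 2. *)
move: x0 y0 xy0; rewrite -!g0.
by have := g2 x; have := g2 y; have := g2 (x + y); lia.
Qed.

Lemma avoidable_lt4 r :
  (3 <= q)%N -> (0 < r < 4)%N -> ~~ unavoidable p 1%Z r.
Proof.
case: r => // r q3 r3.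
(* Truncating at [r] merges the top colors, which creates no rainbow triple. *)
pose c := [ffun x : 'I_p => inord (minn r (unit_color x)) : 'I_r.+1].
have cE x : c x = minn r (unit_color x) :> nat.
  by rewrite ffunE inordK // ltnS geq_minl.
have c_surj : coloring c.
  apply/forallP => a; apply/existsP.
  have lt_a3 : (a < 3)%N by have := ltn_ord a; lia.
  (* The elements 0, 1, 2 have colors 0, 1, 2; here 2 differs from -1 because [p] is not 3. *)
  exists (inord a); rewrite -val_eqE /= cE.
  have -> : unit_color (inord a) = a.
    rewrite /unit_color -!val_eqE /= inordK; last by rewrite /p; lia.
    rewrite !modn_small; [|by rewrite /p; lia ..].
    case: (nat_of_ord a) lt_a3 => [|[|[|]]] //= _.
    by case: eqP => // q1; exfalso; lia.
  by apply/eqP/minn_idPr; rewrite -ltnS.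
apply/negP => /forallP/(_ c); rewrite c_surj.
move=> /existsP[x /existsP[y /existsP[z]]].
rewrite triple1E => /andP[/eqP <-]; rewrite /rainbow -!val_eqE /= !cE.
by have := unit_color_rainbow_free x y => /= /or3P[] /eqP ->; rewrite eqxx ?andbF.
Qed.

End PrimeOrder.

Theorem theorem1 (p : nat) (p_pr : prime p) (p_ge5 : 5 <= p) : rb p 1%Z = 4.
Proof.
rewrite /rb; case: ex_minnP => m /andP[m_gt0 unav_m] /(_ 4) m_min.
case: p p_pr p_ge5 unav_m m_min => [|[|q]] // p_pr q3 unav_m m_min.
apply/eqP; rewrite eqn_leq m_min ?unavoidable4 //= leqNgt.
apply: contraTN unav_m => m_lt4; apply: avoidable_lt4 => //.
by rewrite m_gt0.
Qed.
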